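(* Let $k\ge1$ be a fixed integer and let $\psi_Y$ be the characteristic function of a probability distribution on $\mathbb{R}$. Suppose that for each $c\in(0,1]$ and each $p\in[0,1)$ there is a stationary generalized AR(1) model $\{Y_{n,i}\}$ with parameters $(k,c,p)$ (as defined in the context), that is, $$\sum_{i=1}^k Y_{n,i}=\begin{cases}\sum_{i=1}^k\epsilon_{n,i}, & \text{with probability } p,\\ \sum_{i=1}^k cY_{n-1,i}+\sum_{i=1}^k\epsilon_{n,i}, & \text{with probability } 1-p,\end{cases}\qquad n\in\mathbb{Z},$$ in which every $Y_{n,i}$ has characteristic function $\psi_Y$ (the law of the innovations $\epsilon_{n,i}$ may depend on $c$ and $p$). Then the distribution of $Y_{n,i}$, i.e. $\psi_Y$, is Harris-randomly self-decomposable (HRSD).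
   Context: CF means characteristic function of a probability distribution on $\mathbb{R}$; $\psi^k(t)=(\psi(t))^k$. Fix an integer $k\ge1$. Stationary generalized AR(1) model with parameters $(k,c,p)$: real random variables $Y_{n,i}$, $\epsilon_{n,i}$ ($n\in\mathbb{Z}$, $1\le i\le k$) such that: for each $n$, $Y_{n,1},\dots,Y_{n,k}$ are i.i.d.; the innovations $\epsilon_{n,i}$ are i.i.d.; for each $n$, the innovations $(\epsilon_{n,1},\dots,\epsilon_{n,k})$ are independent of $(Y_{n-1,1},\dots,Y_{n-1,k})$; the displayed relation for $\sum_{i}Y_{n,i}$ holds for each $n$, where the choice between the two cases (first case with probability $p$, second with probability $1-p$) is made independently of $(Y_{n-1,i})_i$ and $(\epsilon_{n,i})_i$; and the process $\{(Y_{n,1},\dots,Y_{n,k})\}_{n\in\mathbb{Z}}$ is stationary. Harris-randomly self-decomposable (HRSD): a CF $\psi$ is HRSD if for each $c\in(0,1]$ and each $p\in[0,1)$ there exists a CF $\psi_{c,p}$ such that $$\psi(t)=\psi_{c,p}(t)\{p+(1-p)\psi^{k}(ct)\}^{1/k}\quad\text{for all }t\in\mathbb{R}.$$ Here the $k$-th root of a continuous non-vanishing function equal to $1$ at $t=0$ is the unique continuous branch equal to $1$ at $t=0$; for $p=0$, $\{\psi^k(ct)\}^{1/k}$ is read as $\psi(ct)$. *)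

(* Defs.v *)
From HB Require Import structures.
From mathcomp Require Import all_boot all_order all_algebra.
From mathcomp Require Import finmap complex.
From mathcomp Require Import all_classical all_reals all_analysis.

Set Implicit Arguments.
Unset Strict Implicit.
Unset Printing Implicit Defensive.

Import Order.TTheory GRing.Theory Num.Theory.
Import numFieldNormedType.Exports.

Local Open Scope classical_set_scope.
Local Open Scope complex_scope.
Local Open Scope ring_scope.

(* E[exp(itX)] for X ~ mu; the library has no integral of complex-valued
   functions, so real and imaginary parts are integrated separately (both
   integrands are bounded). *)
Definition charfun (R : realType) (mu : probability (measurableTypeR R) R)
    (t : R) : R[i] :=
  (\int[mu]_x cos (t * x)) +i* (\int[mu]_x sin (t * x)).

Definition is_CF (R : realType) (psi : R -> R[i]) : Prop :=
  exists mu : probability (measurableTypeR R) R, psi =1 charfun mu.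

(* g is the continuous branch, equal to 1 at 0, of the k-th root of f. The
   non-vanishing of f is what makes such a branch unique. The topology on the
   codomain is the one induced by the complex modulus. *)
Definition kth_root_branch (R : realType) (k : nat) (f g : R -> R[i]) : Prop :=
  [/\ forall t, f t != 0,
      continuous (g : R -> (R[i])^o),
      g 0 = 1
    & forall t, g t ^+ k = f t].

(* g(t) = {p + (1 - p) psi^k(ct)}^{1/k}, read as psi(ct) when p = 0. *)
Definition harris_root (R : realType) (k : nat) (c p : R) (psi g : R -> R[i]) :
    Prop :=
  if p == 0 then forall t, g t = psi (c * t)
  else kth_root_branch k
         (fun t => p%:C + (1 - p)%:C * psi (c * t) ^+ k) g.

Definition HRSD (R : realType) (k : nat) (psi : R -> R[i]) : Prop :=
  is_CF psi /\
  forall c p : R, 0 < c <= 1 -> 0 <= p < 1 ->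
    exists psicp g : R -> R[i],
      [/\ is_CF psicp, harris_root k c p psi g
        & forall t, psi t = psicp t * g t].

Definition identically_distributed (R : realType) (d : measure_display)
    (T : measurableType d) (P : probability T R) (I : Type)
    (X : I -> {RV P >-> measurableTypeR R}) : Prop :=
  forall (i j : I) (A : set (measurableTypeR R)), measurable A ->
    distribution P (X i) A = distribution P (X j) A.

Definition mutually_independent (R : realType) (d : measure_display)
    (T : measurableType d) (P : probability T R) (I : choiceType)
    (X : I -> {RV P >-> measurableTypeR R}) : Prop :=
  forall (J : {fset I}) (A : I -> set (measurableTypeR R)),
    (forall i, i \in J -> measurable (A i)) ->
    (P (\bigcap_(i in [set` J]) (X i @^-1` A i)) =
     \prod_(i <- J) P (X i @^-1` A i))%E.

Definition iid (R : realType) (d : measure_display)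
    (T : measurableType d) (P : probability T R) (I : choiceType)
    (X : I -> {RV P >-> measurableTypeR R}) : Prop :=
  mutually_independent X /\ identically_distributed X.

Definition independent_pair (R : realType) (d d1 d2 : measure_display)
    (T : measurableType d) (T1 : measurableType d1) (T2 : measurableType d2)
    (P : probability T R) (X : T -> T1) (Y : T -> T2) : Prop :=
  forall (A : set T1) (B : set T2), measurable A -> measurable B ->
    (P (X @^-1` A `&` Y @^-1` B) = P (X @^-1` A) * P (Y @^-1` B))%E.

Definition rvec (R : realType) (d : measure_display) (T : measurableType d)
    (P : probability T R) (k : nat)
    (X : 'I_k -> {RV P >-> measurableTypeR R}) (w : T) :
    k.-tuple (measurableTypeR R) :=
  [tuple X i w | i < k].

Definition stationary (R : realType) (d d' : measure_display)
    (T : measurableType d) (T' : measurableType d') (P : probability T R)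
    (Z : int -> T -> T') : Prop :=
  forall (m : nat) (s : m.-tuple int) (h : int) (A : set (m.-tuple T')),
    measurable A ->
    P ((fun w => [tuple Z (tnth s j + h) w | j < m]) @^-1` A) =
    P ((fun w => [tuple Z (tnth s j) w | j < m]) @^-1` A).

(* chi n is the selector of the two cases in the recursion at time n: true for
   the first one (probability p), false for the second one. *)
Record stationary_GAR1 (R : realType) (d : measure_display)
    (T : measurableType d) (P : probability T R) (k : nat) (c p : R)
    (Y eps : int -> 'I_k -> {RV P >-> measurableTypeR R})
    (chi : int -> {RV P >-> bool}) : Prop := StationaryGAR1 {
  gar1_Y_iid : forall n, iid (Y n);
  gar1_eps_iid : iid (fun ni : int * 'I_k => eps ni.1 ni.2);
  gar1_eps_indep : forall n,
    independent_pair P (rvec (eps n)) (rvec (Y (n - 1)));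
  gar1_chi_law : forall n, P (chi n @^-1` [set true]) = p%:E;
  gar1_chi_indep : forall n,
    independent_pair P (chi n)
      (fun w => (rvec (Y (n - 1)) w, rvec (eps n) w));
  gar1_recursion : forall n, {ae P, forall w,
    \sum_(i < k) Y n i w =
      if chi n w then \sum_(i < k) eps n i w
      else \sum_(i < k) c * Y (n - 1) i w + \sum_(i < k) eps n i w};
  gar1_stationary : stationary P (fun n => rvec (Y n))
}.

(* Main.v *)
Require Import Defs.
From mathcomp Require Import all_boot all_order all_algebra.
From mathcomp Require Import finmap complex ring lra.
From mathcomp Require Import all_classical all_reals all_analysis.
From mathcomp Require Import measurable_realfun.

Set Implicit Arguments.
Unset Strict Implicit.
Unset Printing Implicit Defensive.

Import Order.TTheory GRing.Theory Num.Theory.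
Import numFieldNormedType.Exports.

Local Open Scope classical_set_scope.
Local Open Scope complex_scope.
Local Open Scope ring_scope.

(** Comparing characteristic functions on both sides of the recursion turns the
    model with parameters [(k, c, p)] into the functional equation
      [psi(t)^k = phi(t)^k * (p + (1 - p) * psi(c t)^k)],
    where [phi] is the characteristic function of one innovation
    ([GAR1_functional_equation]). It remains to extract k-th roots.

    The decisive point is that [psi] never vanishes. Take [c = 1]. A zero of
    [psi] at [2 t] is a zero of [phi] at [2 t], and a characteristic function
    that vanishes at [2 t] satisfies [|phi(t)|^2 <= 1/2]
    ([charfun_sqr_le_half]). But if [psi(t)] is nonzero, the equation forces
    [|phi(t)|] to approach 1 as [p] tends to 0. Hence [psi(t) <> 0] implies
    [psi(2 t) <> 0] ([nonvanishing_double]), and since [psi] is continuous with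
    [psi(0) = 1], doubling from a neighbourhood of 0 reaches every point.

    Once [psi] has no zero, neither has [phi] nor [p + (1 - p) * psi(c t)^k], and
    the branch of the k-th root needs no construction: [psi / phi] is
    continuous, equals 1 at 0, and its k-th power is [p + (1 - p) * psi(c t)^k]. For
    [p = 0] the quotient of [psi / phi] by [psi(c t)] is a continuous
    k-th root of unity equal to 1 at 0, so it is constantly 1
    ([continuous_unity_root_eq1]).

    The functional equation itself rests on the product rule for expectations
    of bounded functions of independent variables. It is obtained from the
    rule for events by replacing indicators by bounded functions one variable
    at a time ([RexpectationM_of_indic]). *)

(** * Bounded measurable functions and their expectations *)

Definition bounded_measurable (R : realType) d (T : measurableType d)
    (f : T -> R) :=
  measurable_fun setT f /\ exists M : R, forall x, `|f x| <= M.

Section BoundedMeasurable.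
Context (R : realType) d (T : measurableType d).
Implicit Types f g : T -> R.

Lemma bounded_measurable_cst (a : R) : bounded_measurable (fun _ : T => a).
Proof. by split; [exact: measurable_cst | exists `|a|]. Qed.

Lemma bounded_measurableD f g : bounded_measurable f -> bounded_measurable g ->
  bounded_measurable (fun x => f x + g x).
Proof.
move=> [mf [M fM]] [mg [N gN]]; split; first exact: measurable_funD.
by exists (M + N) => x; rewrite (le_trans (ler_normD _ _))// lerD.
Qed.

Lemma bounded_measurableM f g : bounded_measurable f -> bounded_measurable g ->
  bounded_measurable (fun x => f x * g x).
Proof.
move=> [mf [M fM]] [mg [N gN]]; split; first exact: measurable_funM.
by exists (M * N) => x; rewrite normrM ler_pM.
Qed.

Lemma bounded_measurableB f g : bounded_measurable f -> bounded_measurable g ->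
  bounded_measurable (fun x => f x - g x).
Proof.
move=> bf bg; under [X in bounded_measurable X]eq_fun do rewrite -mulN1r.
by apply: bounded_measurableD => //; apply: bounded_measurableM => //;
  exact: bounded_measurable_cst.
Qed.

Lemma bounded_measurable_sum I (s : seq I) (h : I -> T -> R) :
  (forall i, bounded_measurable (h i)) ->
  bounded_measurable (fun x => \sum_(i <- s) h i x).
Proof.
move=> bh; elim: s => [|i s IH].
  under [X in bounded_measurable X]eq_fun do rewrite big_nil.
  exact: bounded_measurable_cst.
under [X in bounded_measurable X]eq_fun do rewrite big_cons.
exact: bounded_measurableD.
Qed.

Lemma bounded_measurable_indic (A : set T) :
  measurable A -> bounded_measurable (\1_A : T -> R).
Proof.
move=> mA; split; first exact: measurable_indic.
by exists 1 => x; rewrite indicE; case: (_ \in _); rewrite ?normr1 ?normr0.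
Qed.

Lemma bounded_measurable_comp d' (T' : measurableType d') (X : T -> T')
    (h : T' -> R) : measurable_fun setT X -> bounded_measurable h ->
  bounded_measurable (fun x => h (X x)).
Proof.
move=> mX [mh [M hM]]; split; first exact: measurableT_comp.
by exists M => x.
Qed.

End BoundedMeasurable.

Section Expectation.
Context (R : realType) d (T : measurableType d) (P : probability T R).
Implicit Types f g : T -> R.

Lemma bounded_measurable_integrable f : bounded_measurable f ->
  P.-integrable setT (EFin \o f).
Proof.
move=> [mf [M fM]]; apply: measurable_bounded_integrable => //.
  by rewrite ltey_eq fin_num_measure.
exists M; split; first exact: num_real.
by move=> N MN x _; exact: le_trans (fM x) (ltW MN).
Qed.

Let bi := bounded_measurable_integrable.

Lemma RexpectationD f g : bounded_measurable f -> bounded_measurable g ->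
  \int[P]_x (f x + g x) = \int[P]_x f x + \int[P]_x g x.
Proof. by move=> bf bg; rewrite RintegralD//; exact: bi. Qed.

Lemma RexpectationB f g : bounded_measurable f -> bounded_measurable g ->
  \int[P]_x (f x - g x) = \int[P]_x f x - \int[P]_x g x.
Proof. by move=> bf bg; rewrite RintegralB//; exact: bi. Qed.

Lemma RexpectationZ (a : R) f : bounded_measurable f ->
  \int[P]_x (a * f x) = a * \int[P]_x f x.
Proof. by move=> bf; rewrite RintegralZl//; exact: bi. Qed.

Lemma Rexpectation_cst (a : R) : \int[P]_x a = a.
Proof.
rewrite Rintegral_cst//; set Q := (X in fine X).
by have -> : Q = 1%E; [exact: probability_setT | rewrite mulr1].
Qed.

Lemma Rexpectation_sum I (s : seq I) (h : I -> T -> R) :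
  (forall i, bounded_measurable (h i)) ->
  \int[P]_x (\sum_(i <- s) h i x) = \sum_(i <- s) \int[P]_x h i x.
Proof.
move=> bh; elim: s => [|i s IH].
  by under eq_Rintegral do rewrite big_nil; rewrite Rexpectation_cst big_nil.
under eq_Rintegral do rewrite big_cons.
by rewrite RexpectationD ?big_cons ?IH//; exact: bounded_measurable_sum.
Qed.

Lemma ler_Rexpectation f g : bounded_measurable f -> bounded_measurable g ->
  (forall x, f x <= g x) -> \int[P]_x f x <= \int[P]_x g x.
Proof. by move=> bf bg fg; apply: le_Rintegral => //; exact: bi. Qed.

Lemma Rexpectation_norm_le f M : bounded_measurable f ->
  (forall x, `|f x| <= M) -> `|\int[P]_x f x| <= M.
Proof.
move=> bf fM; rewrite ler_norml -{1}(Rexpectation_cst (- M)) -{2}(Rexpectation_cst M).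
by apply/andP; split; apply: ler_Rexpectation => //;
  try exact: bounded_measurable_cst; move=> x; have := fM x; rewrite ler_norml;
  case/andP.
Qed.

Lemma Rexpectation_indic (A : set T) : measurable A ->
  \int[P]_x (\1_A x : R) = fine (P A).
Proof. by move=> mA; rewrite /Rintegral integral_indic// setIT. Qed.

End Expectation.

(** * From indicators to bounded functions *)

Section ProductRule.
Context (R : realType) d d1 (T : measurableType d) (T1 : measurableType d1)
  (P : probability T R).

(** The layer-cake formula in discrete form: among the levels [1, ..., n], those
    that [y] reaches are the first [Num.truncn y]. *)
Lemma sum_nat_le_truncn (n : nat) (y : R) : 0 <= y <= n%:R ->
  \sum_(j < n) ((j.+1)%:R <= y)%R%:R = (Num.truncn y)%:R :> R.
Proof.
move=> /andP[y0 yn].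
have tn : (Num.truncn y <= n)%N.
  by have := le_truncn yn; rewrite natrK.
under eq_bigr => j _ do rewrite -truncn_gt_nat.
rewrite -natr_sum; congr _%:R.
transitivity (\sum_(j < n | (j < Num.truncn y)%N) 1)%N.
  by rewrite [RHS]big_mkcond; apply: eq_bigr => j _; case: ltnP.
by rewrite -(big_ord_widen n (fun=> 1%N) tn) sum1_card card_ord.
Qed.

(** A function with values in [0, 1] is within [1 / n] of the average of the
    indicators of its superlevel sets [f >= j / n], so the product rule passes
    from indicators to the average by linearity and to [f] by uniform
    approximation. An affine change of [f] gives every bounded function. Only
    the variable [X] is treated, [Z] being fixed: this is what allows the
    variables of a family to be treated one after the other. *)
Lemma RexpectationM_of_indic (X : T -> T1) (Z : T -> R) :
  measurable_fun setT X -> bounded_measurable Z ->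
  (forall A, measurable A ->
    \int[P]_w (\1_A (X w) * Z w) = \int[P]_w \1_A (X w) * \int[P]_w Z w) ->
  forall f : T1 -> R, bounded_measurable f ->
    \int[P]_w (f (X w) * Z w) = \int[P]_w f (X w) * \int[P]_w Z w.
Proof.
move=> mX bZ indepA.
have unit_case f : bounded_measurable f -> (forall x, 0 <= f x <= 1) ->
    \int[P]_w (f (X w) * Z w) = \int[P]_w f (X w) * \int[P]_w Z w.
  move=> bf f01.
  have [_ [M ZM]] := bZ.
  pose A (n j : nat) := [set x | j.+1%:R <= n.+1%:R * f x].
  have mA n j : measurable (A n j).
    have [mf _] := bounded_measurableM (bounded_measurable_cst T1 n.+1%:R) bf.
    rewrite -[A n j]setTI (_ : A n j = (fun x => n.+1%:R * f x) @^-1` `[j.+1%:R, +oo[).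
      by apply: mf => //; exact: measurable_itv.
    by apply/seteqP; split => x /=; rewrite in_itv/= andbT.
  pose g n x : R := n.+1%:R^-1 * \sum_(j < n.+1) \1_(A n j) x.
  have bg n : bounded_measurable (g n).
    apply: bounded_measurableM; first exact: bounded_measurable_cst.
    by apply: bounded_measurable_sum => j; exact: bounded_measurable_indic.
  have fg n x : `|f x - g n x| <= n.+1%:R^-1.
    have /andP[f0 f1] := f01 x.
    have n0 : 0 < n.+1%:R :> R by rewrite ltr0n.
    have nf0 : 0 <= n.+1%:R * f x by rewrite mulr_ge0// ltW.
    rewrite /g; under eq_bigr => j _ do
      rewrite indicE (_ : (x \in A n j) = (j.+1%:R <= n.+1%:R * f x)) ?mem_setE//.
    rewrite sum_nat_le_truncn; last by rewrite nf0 ler_piMr// ltW.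
    have /andP[t1 t2] := truncn_itv nf0.
    rewrite -(ler_pM2l n0) -[X in X * `|_|](gtr0_norm n0) -normrM mulrBr mulfV ?gt_eqF//.
    rewrite mulrA mulfV ?gt_eqF// mul1r ger0_norm ?subr_ge0//.
    by rewrite lerBlDr addrC natr1 ltW.
  have gZ n : \int[P]_w (g n (X w) * Z w) = \int[P]_w g n (X w) * \int[P]_w Z w.
    have bA j : bounded_measurable (fun w => \1_(A n j) (X w) : R).
      by apply: bounded_measurable_comp => //; exact: bounded_measurable_indic.
    rewrite /g; under eq_Rintegral do rewrite -mulrA mulr_suml.
    rewrite !RexpectationZ; last 2 first.
      by apply: bounded_measurable_sum.
      by apply: bounded_measurable_sum => j; exact: bounded_measurableM.
    rewrite !Rexpectation_sum//; last by move=> j; exact: bounded_measurableM.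
    by rewrite -mulrA mulr_suml; congr (_ * _); apply: eq_bigr => j _; exact: indepA.
  have bfX := bounded_measurable_comp mX bf.
  have bgX n := bounded_measurable_comp mX (bg n).
  apply/eqP; rewrite -subr_eq0 -normr_le0; apply/(@ler_addgt0Pl R) => e e0.
  have M0 : 0 <= M.
    have [t0 _] : [set: T] !=set0.
      apply/set0P/eqP => T0; have := probability_setT P.
      by rewrite T0 measure0 => /eqP; rewrite eq_sym onee_eq0.
    exact: le_trans (normr_ge0 _) (ZM t0).
  set D := `|_|; have Dn n : D <= n.+1%:R^-1 * M + n.+1%:R^-1 * M.
    have -> : D = `|\int[P]_w ((f (X w) - g n (X w)) * Z w) -
                 (\int[P]_w (f (X w) - g n (X w))) * \int[P]_w Z w|.
      congr `|_|; under [in RHS]eq_Rintegral do rewrite mulrBl.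
      rewrite !RexpectationB//; try exact: bounded_measurableM.
      rewrite gZ; ring.
    rewrite (le_trans (ler_normB _ _))// lerD//.
      apply: Rexpectation_norm_le => [|w].
        by apply: bounded_measurableM => //; exact: bounded_measurableB.
      by rewrite normrM ler_pM.
    rewrite normrM ler_pM//; apply: Rexpectation_norm_le => //.
    exact: bounded_measurableB.
  (* [D] is at most [2 M / (n + 1)]; choose [n] to bring this below [e]. *)
  rewrite addr0; have [n /ltW Mn] : exists n, 2 * M / e < n.+1%:R.
    exists (Num.truncn (2 * M / e)).
    exact: truncnS_gt.
  have : 2 * M / n.+1%:R <= e.
    by rewrite ler_pdivrMr ?ltr0n// [leRHS]mulrC -ler_pdivrMr.
  apply: le_trans; apply: (le_trans (Dn n)).
  by rewrite le_eqVlt; apply/orP; left; apply/eqP; ring.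
move=> f bf.
have [_ [B fB]] := bf.
(* [h] rescales [f] into [0, 1]; adding 1 keeps [C] positive when [B = 0]. *)
pose C := `|B| + 1.
have C0 : 0 < C by rewrite ltr_pwDr.
pose h x := (2 * C)^-1 * (f x + C).
have bh : bounded_measurable h.
  apply: bounded_measurableM; first exact: bounded_measurable_cst.
  by apply: bounded_measurableD => //; exact: bounded_measurable_cst.
have h01 x : 0 <= h x <= 1.
  have : `|f x| <= C by rewrite (le_trans (fB x))// (le_trans (ler_norm _))// lerDl.
  rewrite ler_norml => /andP[fC Cf].
  rewrite /h mulr_ge0 ?invr_ge0 ?mulr_ge0 ?(ltW C0)//=; last by rewrite -lerBlDr sub0r.
  by rewrite mulrC ler_pdivrMr ?mulr_gt0//; lra.
have fh x : f x = 2 * C * h x - C.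
  by rewrite /h mulrA mulfV ?mul1r ?addrK// gt_eqF// mulr_gt0.
clearbody h.
have bhX := bounded_measurable_comp mX bh.
have hZ := unit_case h bh h01.
under eq_Rintegral do rewrite fh mulrBl -(mulrA (2 * C)).
under [X in _ = X * _]eq_Rintegral do rewrite fh.
have bC := @bounded_measurable_cst R _ T.
rewrite !RexpectationB ?RexpectationZ ?Rexpectation_cst ?hZ//; first ring.
all: by do ?[apply: bounded_measurableM => //].
Qed.
End ProductRule.

(** * Expectation of bounded complex functions *)

Section ComplexExpectation.
Context (R : realType).

Definition bounded_measurableC d (T : measurableType d) (Z : T -> R[i]) :=
  bounded_measurable (fun w => complex.Re (Z w)) /\
  bounded_measurable (fun w => complex.Im (Z w)).

Definition expectationC d (T : measurableType d) (P : probability T R)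
    (Z : T -> R[i]) : R[i] :=
  (\int[P]_w complex.Re (Z w)) +i* (\int[P]_w complex.Im (Z w)).

Definition cis (x : R) : R[i] := cos x +i* sin x.

Definition cindic T (A : set T) (x : T) : R[i] := (\1_A x)%:C.

Lemma cindicT T (x : T) : cindic [set: T] x = 1.
Proof. by rewrite /cindic indicT. Qed.

Lemma ReM (x y : R[i]) : complex.Re (x * y) =
  complex.Re x * complex.Re y - complex.Im x * complex.Im y.
Proof. by case: x; case: y. Qed.

Lemma ImM (x y : R[i]) : complex.Im (x * y) =
  complex.Re x * complex.Im y + complex.Im x * complex.Re y.
Proof. by case: x; case: y. Qed.

Lemma ReD (x y : R[i]) : complex.Re (x + y) = complex.Re x + complex.Re y.
Proof. by case: x; case: y. Qed.

Lemma ImD (x y : R[i]) : complex.Im (x + y) = complex.Im x + complex.Im y.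
Proof. by case: x; case: y. Qed.

Lemma cis0 : cis 0 = 1.
Proof. by rewrite /cis cos0 sin0. Qed.

Lemma cisD x y : cis (x + y) = cis x * cis y.
Proof. by apply/eqP; rewrite eq_complex ReM ImM /= cosD sinD addrC eqxx addrC eqxx. Qed.

Lemma cis_sum I (s : seq I) (x : I -> R) :
  cis (\sum_(i <- s) x i) = \prod_(i <- s) cis (x i).
Proof. exact: (big_morph cis cisD cis0). Qed.

Context d (T : measurableType d).
Implicit Types Z W : T -> R[i].

Lemma bounded_measurableC_cst (a : R[i]) : bounded_measurableC (fun _ : T => a).
Proof. by split; exact: bounded_measurable_cst. Qed.

Lemma bounded_measurableCM Z W :
  bounded_measurableC Z -> bounded_measurableC W ->
  bounded_measurableC (fun w => Z w * W w).
Proof.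
move=> [rZ iZ] [rW iW]; split.
  under [X in bounded_measurable X]eq_fun do rewrite ReM.
  by apply: bounded_measurableB; exact: bounded_measurableM.
under [X in bounded_measurable X]eq_fun do rewrite ImM.
by apply: bounded_measurableD; exact: bounded_measurableM.
Qed.

Lemma bounded_measurableC_prod I (s : seq I) (p : pred I) (Z : I -> T -> R[i]) :
  (forall i, bounded_measurableC (Z i)) ->
  bounded_measurableC (fun w => \prod_(i <- s | p i) Z i w).
Proof.
move=> bZ; elim: s => [|i s IH].
  under [X in bounded_measurableC X]eq_fun do rewrite big_nil.
  exact: bounded_measurableC_cst.
under [X in bounded_measurableC X]eq_fun do rewrite big_cons.
by case: (p i) => //; exact: bounded_measurableCM.
Qed.

Lemma bounded_measurableC_indic (A : set T) :
  measurable A -> bounded_measurableC (cindic A).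
Proof.
move=> mA; split; first exact: bounded_measurable_indic.
exact: bounded_measurable_cst.
Qed.

Lemma bounded_measurableC_cis (X : T -> R) :
  measurable_fun setT X -> bounded_measurableC (fun w => cis (X w)).
Proof.
move=> mX; split; split.
- apply: (measurableT_comp _ mX).
  exact: continuous_measurable_fun (@continuous_cos R).
- by exists 1 => x; exact: cos_max.
- apply: (measurableT_comp _ mX).
  exact: continuous_measurable_fun (@continuous_sin R).
- by exists 1 => x; exact: sin_max.
Qed.

Lemma bounded_measurableC_comp d' (T' : measurableType d') (X : T' -> T) Z :
  measurable_fun setT X -> bounded_measurableC Z ->
  bounded_measurableC (fun w => Z (X w)).
Proof. by move=> mX [rZ iZ]; split;
  [exact: (bounded_measurable_comp mX rZ) | exact: (bounded_measurable_comp mX iZ)].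
Qed.

Context (P : probability T R).

Lemma eq_expectationC Z W : Z =1 W -> expectationC P Z = expectationC P W.
Proof. by move=> ZW; congr expectationC; apply/funext. Qed.

Lemma expectationCD Z W : bounded_measurableC Z -> bounded_measurableC W ->
  expectationC P (fun w => Z w + W w) = expectationC P Z + expectationC P W.
Proof.
move=> [rZ iZ] [rW iW]; apply/eqP; rewrite eq_complex /=.
under eq_Rintegral do rewrite ReD.
rewrite RexpectationD// eqxx /=; under eq_Rintegral do rewrite ImD.
by rewrite RexpectationD.
Qed.

Lemma expectationC_indic (A : set T) : measurable A ->
  expectationC P (cindic A) = (fine (P A))%:C.
Proof.
by move=> mA; rewrite /expectationC /= Rexpectation_cst Rexpectation_indic.
Qed.

Lemma expectationCM_of_indic d1 (T1 : measurableType d1) (X : T -> T1) (Z : T -> R[i]) :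
  measurable_fun setT X -> bounded_measurableC Z ->
  (forall A, measurable A ->
    expectationC P (fun w => cindic A (X w) * Z w) =
    expectationC P (fun w => cindic A (X w)) * expectationC P Z) ->
  forall f : T1 -> R[i], bounded_measurableC f ->
    expectationC P (fun w => f (X w) * Z w) =
    expectationC P (fun w => f (X w)) * expectationC P Z.
Proof.
move=> mX [bR bI] indepA f [bfR bfI].
have /all_and2[indepR indepI] : forall A, (measurable A ->
    \int[P]_w (\1_A (X w) * complex.Re (Z w)) =
    \int[P]_w \1_A (X w) * \int[P]_w complex.Re (Z w)) /\ (measurable A ->
    \int[P]_w (\1_A (X w) * complex.Im (Z w)) =
    \int[P]_w \1_A (X w) * \int[P]_w complex.Im (Z w)).
  move=> A; split=> mA; have /eqP := indepA A mA; rewrite eq_complex ReM ImM /=;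
    rewrite !Rexpectation_cst !mul0r subr0 addr0 => /andP[/eqP eR /eqP eI].
  - rewrite -eR; apply: eq_Rintegral => w _; by rewrite ReM /= mul0r subr0.
  - rewrite -eI; apply: eq_Rintegral => w _; by rewrite ImM /= mul0r addr0.
have bfRX := bounded_measurable_comp mX bfR.
have bfIX := bounded_measurable_comp mX bfI.
apply/eqP; rewrite eq_complex ReM ImM /=.
under eq_Rintegral do rewrite ReM.
under [X in _ && (X == _)]eq_Rintegral do rewrite ImM.
rewrite RexpectationB ?RexpectationD; try exact: bounded_measurableM.
rewrite (RexpectationM_of_indic mX bR indepR bfR).
rewrite (RexpectationM_of_indic mX bI indepI bfI).
rewrite (RexpectationM_of_indic mX bI indepI bfR).
by rewrite (RexpectationM_of_indic mX bR indepR bfI) !eqxx.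
Qed.

End ComplexExpectation.

(** * Independence and products of expectations *)

Section Independence.
Context (R : realType) d (T : measurableType d) (P : probability T R).

Lemma expectationC_indicI (A B : set T) : measurable A -> measurable B ->
  P (A `&` B) = (P A * P B)%E ->
  expectationC P (fun w => cindic R A w * cindic R B w) =
  expectationC P (cindic R A) * expectationC P (cindic R B).
Proof.
move=> mA mB AB.
have -> : (fun w => cindic R A w * cindic R B w) = cindic R (A `&` B).
  by apply/funext => w; rewrite /cindic indicI -rmorphM.
rewrite !expectationC_indic//; last exact: measurableI.
by rewrite -rmorphM AB fineM ?fin_num_measure.
Qed.

Lemma expectationC_independent_pair d1 d2 (T1 : measurableType d1)
    (T2 : measurableType d2) (X : T -> T1) (Y : T -> T2)
    (f : T1 -> R[i]) (g : T2 -> R[i]) :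
  measurable_fun setT X -> measurable_fun setT Y -> independent_pair P X Y ->
  bounded_measurableC f -> bounded_measurableC g ->
  expectationC P (fun w => f (X w) * g (Y w)) =
  expectationC P (fun w => f (X w)) * expectationC P (fun w => g (Y w)).
Proof.
move=> mX mY XY bf bg.
have mXA A : measurable A -> measurable (X @^-1` A).
  by move=> mA; rewrite -[_ @^-1` _]setTI; exact: mX.
have mYB B : measurable B -> measurable (Y @^-1` B).
  by move=> mB; rewrite -[_ @^-1` _]setTI; exact: mY.
have bgY := bounded_measurableC_comp mY bg.
apply: (expectationCM_of_indic mX bgY) => // A mA.
have bAX := bounded_measurableC_comp mX (bounded_measurableC_indic R mA).
under [LHS]eq_expectationC do rewrite mulrC.
rewrite [RHS]mulrC; apply: (expectationCM_of_indic mY bAX) => // B mB.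
under [LHS]eq_expectationC do rewrite mulrC.
rewrite [RHS]mulrC; apply: (expectationC_indicI (mXA _ mA) (mYB _ mB)).
exact: XY.
Qed.

(** By induction on a list of indices outside of which every function is an
    indicator: for the empty list the rule is the independence of events, and
    [expectationCM_of_indic] lets one more index into the list. *)
Lemma expectationC_prod (I : finType) d1 (T1 : measurableType d1)
    (X : I -> T -> T1) :
  (forall i, measurable_fun setT (X i)) ->
  (forall A : I -> set T1, (forall i, measurable (A i)) ->
    P (\bigcap_i (X i @^-1` A i)) = (\prod_i P (X i @^-1` A i))%E) ->
  forall f : I -> T1 -> R[i], (forall i, bounded_measurableC (f i)) ->
  expectationC P (fun w => \prod_i f i (X i w)) =
  \prod_i expectationC P (fun w => f i (X i w)).
Proof.
move=> mX indepX f bf.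
have mXA i A : measurable A -> measurable (X i @^-1` A).
  by move=> mA; rewrite -[_ @^-1` _]setTI; exact: mX.
suff main (s : seq I) (g : I -> T1 -> R[i]) : (forall i, bounded_measurableC (g i)) ->
    (forall i, i \notin s -> exists2 A, measurable A & g i = cindic R A) ->
    expectationC P (fun w => \prod_i g i (X i w)) =
    \prod_i expectationC P (fun w => g i (X i w)).
  by apply: (main (enum I)) => // i; rewrite mem_enum.
elim: s g => [|i s IH] g bg gs.
  have /choice[A gA] : forall i, exists A, measurable A /\ g i = cindic R A.
    by move=> i; have [//|A mA gA] := gs i; exists A.
  have mA i : measurable (A i) by case: (gA i).
  have gX w : \prod_i g i (X i w) = cindic R (\bigcap_i (X i @^-1` A i)) w.
    under eq_bigr do rewrite (gA _).2.
    rewrite /cindic -rmorph_prod; congr (_%:C); rewrite [RHS]indicE.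
    have [wA|wA] := boolP (w \in _).
      rewrite big1// => i _; rewrite indicE mem_set//.
      by move: wA; rewrite inE => /(_ i Logic.I).
    have [i iA] : exists i, ~ A i (X i w).
      by apply/existsNP => XA; move: wA; rewrite notin_setE; apply=> i _; exact: XA.
    by rewrite (bigD1 i)//= indicE memNset// mul0r.
  under eq_expectationC do rewrite gX.
  rewrite expectationC_indic; last first.
    by apply: fin_bigcap_measurable => // i _; exact: mXA.
  rewrite indepX//.
  under [RHS]eq_bigr => i _.
    rewrite (gA i).2.
    rewrite [expectationC _ _](expectationC_indic P (mXA i _ (mA i))).
    over.
  rewrite -rmorph_prod; congr (_%:C).
  rewrite -[RHS]/(fine (_)%:E) -prodEFin; congr fine.
  by apply: eq_bigr => i _; rewrite fineK// fin_num_measure//; exact: mXA.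
pose upd A j := if j == i then cindic R A else g j.
have bupd A : measurable A -> forall j, bounded_measurableC (upd A j).
  move=> mA j; rewrite /upd; case: ifP => // _; exact: bounded_measurableC_indic.
have IHA A : measurable A ->
    expectationC P (fun w => cindic R A (X i w) * \prod_(j | j != i) g j (X j w)) =
    expectationC P (fun w => cindic R A (X i w)) *
    \prod_(j | j != i) expectationC P (fun w => g j (X j w)).
  move=> mA; have : expectationC P (fun w => \prod_j upd A j (X j w)) =
      \prod_j expectationC P (fun w => upd A j (X j w)).
    apply: IH => [|j js]; first exact: bupd.
    rewrite /upd; case: eqP => [_|/eqP ji]; first by exists A.
    by apply: gs; rewrite in_cons negb_or ji.
  have updi : upd A i = cindic R A by rewrite /upd eqxx.
  have updj j : j != i -> upd A j = g j by rewrite /upd => /negbTE->.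
  rewrite [X in _ = X -> _](bigD1 i)//= updi.
  under [X in _ = _ * X -> _]eq_bigr => j ji do rewrite updj//.
  move=> <-; apply: eq_expectationC => w.
  rewrite [RHS](bigD1 i)//= updi; congr (_ * _).
  by apply: eq_bigr => j ji; rewrite updj.
have bZ : bounded_measurableC (fun w => \prod_(j | j != i) g j (X j w)).
  by apply: bounded_measurableC_prod => j; exact: bounded_measurableC_comp.
(* The full event turns the rule for [indicator * product] into the rule
   for the product alone. *)
have EZ : expectationC P (fun w => \prod_(j | j != i) g j (X j w)) =
    \prod_(j | j != i) expectationC P (fun w => g j (X j w)).
  have := IHA _ measurableT.
  have E1 : expectationC P (fun w => cindic R [set: T1] (X i w)) = 1.
    under eq_expectationC do rewrite cindicT.
    by rewrite /expectationC /= !Rexpectation_cst.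
  rewrite E1 mul1r => <-; apply: eq_expectationC => w.
  by rewrite cindicT mul1r.
rewrite (bigD1 i)//= -EZ.
under eq_expectationC do rewrite (bigD1 i)//=.
apply: (expectationCM_of_indic (mX i) bZ) => // A mA.
by rewrite IHA// EZ.
Qed.

(** Events attached to the indices [i] are transported along [h]; off the image
    of [h] the event [B j] is the whole line, which the finite index set
    [h @` I] does not see. *)
Lemma mutually_independent_subfamily (I : finType) (J : choiceType)
    (h : I -> J) (X : J -> {RV P >-> measurableTypeR R}) :
  injective h -> mutually_independent X ->
  forall A : I -> set (measurableTypeR R), (forall i, measurable (A i)) ->
    P (\bigcap_i (X (h i) @^-1` A i)) = (\prod_i P (X (h i) @^-1` A i))%E.
Proof.
move=> injh indepX A mA.
pose B j := [set x | forall i, h i = j -> A i x].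
have Bh i : B (h i) = A i.
  by apply/seteqP; split => x /=; [apply | move=> Ax i' /injh ->].
have := indepX [fset h i | i in I]%fset B.
have -> : \bigcap_(j in [set` [fset h i | i in I]%fset]) (X j @^-1` B j) =
   \bigcap_i (X (h i) @^-1` A i).
  apply/seteqP; split => w /= wA.
    by move=> i _; rewrite -Bh; apply: wA; exact: in_imfset.
  by move=> _ /imfsetP[i _ ->]; rewrite Bh; exact: wA.
move=> ->; last by move=> _ /imfsetP[i _ ->]; rewrite Bh.
rewrite big_imfset//=; last by move=> ? ? _ _; exact: injh.
rewrite big_enum/=.
by apply: eq_bigr => i _; rewrite Bh.
Qed.

End Independence.

(** * Characteristic functions and the functional equation *)

Section CharacteristicFunctions.
Context (R : realType) d (T : measurableType d) (P : probability T R).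

Lemma charfun_distribution (X : {RV P >-> measurableTypeR R}) t :
  charfun (distribution P X) t = expectationC P (fun w => cis (t * X w)).
Proof.
have mtX : measurable_fun setT (fun x : measurableTypeR R => t * x).
  exact: measurable_funM.
have [bc bs] := bounded_measurableC_cis mtX.
have mX : measurable_fun setT X by exact: measurable_funPT.
have push (f : measurableTypeR R -> R) : bounded_measurable f ->
    \int[distribution P X]_x f x = \int[P]_w f (X w).
  move=> bf; rewrite /Rintegral integral_distribution//.
    by apply/measurable_EFinP; case: bf.
  exact: (bounded_measurable_integrable P (bounded_measurable_comp mX bf)).
by congr (_ +i* _); rewrite push.
Qed.

Lemma charfun_eq_distribution (X Y : {RV P >-> measurableTypeR R}) t :
  (forall A, measurable A -> distribution P X A = distribution P Y A) ->
  charfun (distribution P X) t = charfun (distribution P Y) t.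
Proof.
move=> XY; congr (_ +i* _); congr fine;
  by apply: eq_measure_integral => A mA _; exact: XY.
Qed.

(** The reindexing [h] covers both uses of the rule: the variables [Y n i] at a
    fixed time, with [h] the identity, and one row of the doubly indexed
    innovations. *)
Lemma charfun_sum (k : nat) (J : choiceType) (h : 'I_k -> J)
    (X : J -> {RV P >-> measurableTypeR R}) (z : R[i]) t :
  injective h -> mutually_independent X ->
  (forall i, charfun (distribution P (X (h i))) t = z) ->
  expectationC P (fun w => cis (t * \sum_(i < k) X (h i) w)) = z ^+ k.
Proof.
move=> injh indepX Xz.
under eq_expectationC do rewrite mulr_sumr cis_sum.
have mX i : measurable_fun setT (X (h i)) by exact: measurable_funPT.
rewrite (expectationC_prod mX (mutually_independent_subfamily injh indepX)
  (f := fun _ x => cis (t * x))).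
  under eq_bigr do rewrite -charfun_distribution Xz.
  by rewrite prodr_const card_ord.
by move=> _; apply: bounded_measurableC_cis; exact: measurable_funM.
Qed.

Lemma ae_eq_expectationC (Z W : T -> R[i]) :
  bounded_measurableC Z -> bounded_measurableC W ->
  {ae P, forall w, Z w = W w} -> expectationC P Z = expectationC P W.
Proof.
move=> [[mrZ _] [miZ _]] [[mrW _] [miW _]] ZW; congr (_ +i* _); congr fine;
  (apply: ae_eq_integral => //; [exact/measurable_EFinP..|]);
  by apply: filterS ZW => w -> .
Qed.

End CharacteristicFunctions.

(** Only one step of the recursion is used, at time 0. Splitting the
    expectation of [exp (i t sum Y)] over the two values of the selector,
    which is independent of the pair (past, innovations), gives
    [p phi^k + (1 - p) phi^k psi(c t)^k]. Since the [eps 0 i] have the same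
    law, any index [i0] may serve to define [phi]. *)
Lemma GAR1_functional_equation (R : realType) d (T : measurableType d)
    (P : probability T R) (k : nat) (c p : R)
    (Y eps : int -> 'I_k -> {RV P >-> measurableTypeR R})
    (chi : int -> {RV P >-> bool}) (psi : R -> R[i]) (i0 : 'I_k) :
  stationary_GAR1 c p Y eps chi ->
  (forall n i t, charfun (distribution P (Y n i)) t = psi t) ->
  forall t, psi t ^+ k = charfun (distribution P (eps 0 i0)) t ^+ k *
    (p%:C + (1 - p)%:C * psi (c * t) ^+ k).
Proof.
case=> iidY [indep_eps id_eps] eps_Y chi_law chi_indep recursion _ Ypsi t.
have mRV (X : {RV P >-> measurableTypeR R}) : measurable_fun setT (X : T -> R).
  exact: (measurable_funPT X).
set phi := charfun _ t.
pose SY n w := \sum_(i < k) Y n i w.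
pose Se w := \sum_(i < k) eps 0 i w.
have mSY n : measurable_fun setT (SY n).
  by apply: measurable_sum => i; exact: mRV.
have mSe : measurable_fun setT Se.
  by apply: measurable_sum => i; exact: mRV.
have ESY n s : expectationC P (fun w => cis (s * SY n w)) = psi s ^+ k.
  by apply: (@charfun_sum _ _ _ P k _ id (Y n)) => //; exact: (iidY n).1.
have ESe : expectationC P (fun w => cis (t * Se w)) = phi ^+ k.
  apply: (@charfun_sum _ _ _ P k _ (fun i => (0 : int, i)) (fun ni => eps ni.1 ni.2)) => //.
    by move=> i j [].
  by move=> i; apply: charfun_eq_distribution => A mA; exact: (id_eps (0, i) (0, i0)).
pose V w := (rvec (Y (0 - 1)) w, rvec (eps 0) w).
have mrvec (X : 'I_k -> {RV P >-> measurableTypeR R}) : measurable_fun setT (rvec X).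
  apply/measurable_fun_tnthP => i.
  rewrite (_ : _ \o _ = X i); first exact: mRV.
  by apply/funext => w; rewrite /= tnth_mktuple.
have mV : measurable_fun setT V by exact: measurable_fun_pair.
pose tsum (x : k.-tuple (measurableTypeR R)) : R := \sum_(i < k) tnth x i.
have mtsum : measurable_fun setT tsum.
  by apply: measurable_sum => i; exact: measurable_tnth.
have tsumE (X : 'I_k -> {RV P >-> measurableTypeR R}) w :
    tsum (rvec X w) = \sum_(i < k) X i w.
  by apply: eq_bigr => i _; rewrite tnth_mktuple.
pose cY (v : k.-tuple (measurableTypeR R) * k.-tuple (measurableTypeR R)) :=
  cis (c * t * tsum v.1).
pose ce (v : k.-tuple (measurableTypeR R) * k.-tuple (measurableTypeR R)) :=
  cis (t * tsum v.2).
have bcY : bounded_measurableC cY.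
  apply: bounded_measurableC_cis; apply: measurable_funM => //.
  exact: measurableT_comp.
have bce : bounded_measurableC ce.
  apply: bounded_measurableC_cis; apply: measurable_funM => //.
  exact: measurableT_comp.
have EcY : expectationC P (fun w => ce (V w) * cY (V w)) = phi ^+ k * psi (c * t) ^+ k.
  rewrite -ESe -(ESY (0 - 1)) /ce /cY /=.
  rewrite (expectationC_independent_pair (f := fun x => cis (t * tsum x))
    (g := fun x => cis (c * t * tsum x)) (mrvec _) (mrvec _) (eps_Y 0)); last 2 first.
  - by apply: bounded_measurableC_cis; exact: measurable_funM.
  - by apply: bounded_measurableC_cis; exact: measurable_funM.
  by congr (_ * _); apply: eq_expectationC => w; rewrite tsumE.
have Ece : expectationC P (fun w => ce (V w)) = phi ^+ k.
  by rewrite -ESe; apply: eq_expectationC => w; rewrite /ce tsumE.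
have mchi : measurable_fun setT (chi 0) by exact: measurable_funPT.
have mb (b : bool) : measurable [set b] by [].
have bchi b := bounded_measurableC_indic R (mb b).
have Echi b : expectationC P (fun w => cindic R [set b] (chi 0 w)) =
    if b then p%:C else (1 - p)%:C.
  rewrite (expectationC_indic P (A := chi 0 @^-1` [set b])); last first.
    by rewrite -[_ @^-1` _]setTI; exact: mchi.
  case: b; first by rewrite chi_law.
  rewrite (_ : _ @^-1` _ = ~` (chi 0 @^-1` [set true])); last first.
    by apply/seteqP; split => w /=; case: (chi 0 w).
  rewrite probability_setC ?chi_law//.
  by rewrite -[_ @^-1` _]setTI; exact: mchi.
(* [Z1] and [Z0] are the contributions of the two cases of the recursion. *)
pose Z1 w := cindic R [set true] (chi 0 w) * ce (V w).
pose Z0 w := cindic R [set false] (chi 0 w) * (ce (V w) * cY (V w)).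
have bZ1 : bounded_measurableC Z1.
  by apply: bounded_measurableCM; [exact: (bounded_measurableC_comp mchi) |
    exact: (bounded_measurableC_comp mV)].
have bcecY := bounded_measurableCM bce bcY.
have bZ0 : bounded_measurableC Z0.
  by apply: bounded_measurableCM; [exact: (bounded_measurableC_comp mchi) |
    exact: (bounded_measurableC_comp mV bcecY)].
have -> : psi t ^+ k = expectationC P (fun w => Z1 w + Z0 w).
  rewrite -(ESY 0); apply: ae_eq_expectationC.
  - by apply: bounded_measurableC_cis; exact: measurable_funM.
  - by case: bZ1 bZ0 => [? ?] [? ?]; split;
      [under [X in bounded_measurable X]eq_fun do rewrite ReD |
       under [X in bounded_measurable X]eq_fun do rewrite ImD];
      exact: bounded_measurableD.
  apply: filterS (recursion 0) => w; rewrite -/(SY 0 w) -/(Se w) => ->.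
  rewrite /Z1 /Z0 /ce /cY /cindic !indicE !tsumE -/(Se w) -/(SY (0 - 1) w).
  have c01 (b b' : bool) : (b \in [set b']) = (b == b').
    by apply/idP/eqP; rewrite inE.
  rewrite !c01; case: (chi 0 w); rewrite !(mul1r, mul0r, addr0, add0r)//.
  by rewrite -mulr_sumr -cisD mulrDr addrC mulrA [t * c]mulrC.
rewrite expectationCD//.
rewrite (expectationC_independent_pair mchi mV (chi_indep 0) (bchi true) bce).
rewrite (expectationC_independent_pair mchi mV (chi_indep 0) (bchi false) bcecY).
by rewrite !Echi Ece EcY; ring.
Qed.

(** * Analytic properties of characteristic functions *)

Section CharfunAnalysis.
Context (R : realType) (mu : probability (measurableTypeR R) R).

Lemma measurable_mulrl (t : R) :
  measurable_fun setT (fun x : measurableTypeR R => t * x).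
Proof. exact: measurable_funM. Qed.

Let bcos t := (bounded_measurableC_cis (measurable_mulrl t)).1.
Let bsin t := (bounded_measurableC_cis (measurable_mulrl t)).2.
Let bcst (a : R) := bounded_measurable_cst (measurableTypeR R) a.

Lemma charfun0 : charfun mu 0 = 1.
Proof.
apply/eqP; rewrite eq_complex /=.
under eq_Rintegral do rewrite mul0r cos0.
under [X in _ && (X == _)]eq_Rintegral do rewrite mul0r sin0.
by rewrite !Rexpectation_cst !eqxx.
Qed.

(** Let [N = |phi(t)|^2] and let [X] be the real part of
    [conj (phi(t)) * exp (i t x)], whose mean is [N]. The function [X^2] is
    [N / 2] plus a combination of [cos (2 t x)] and [sin (2 t x)], which integrate
    to 0. Nonnegativity of the variance of [X] reads [N^2 <= N / 2]. *)
Lemma charfun_sqr_le_half t : charfun mu (2 * t) = 0 ->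
  complex.Re (charfun mu t) ^+ 2 + complex.Im (charfun mu t) ^+ 2 <= 1 / 2.
Proof.
move=> /eqP; rewrite eq_complex /= => /andP[/eqP c2 /eqP s2].
set C := \int[mu]_x cos (t * x); set S := \int[mu]_x sin (t * x).
set N := C ^+ 2 + S ^+ 2.
have /=sq_ge0 : 0 <= \int[mu]_x ((C ^+ 2 - S ^+ 2) / 2 * cos (2 * t * x) +
    C * S * sin (2 * t * x) + (- 2 * N * C) * cos (t * x) +
    (- 2 * N * S) * sin (t * x) + (N / 2 + N ^+ 2)).
  apply: Rintegral_ge0 => x _.
  suff -> : (C ^+ 2 - S ^+ 2) / 2 * cos (2 * t * x) +
    C * S * sin (2 * t * x) + (- 2 * N * C) * cos (t * x) +
    (- 2 * N * S) * sin (t * x) + (N / 2 + N ^+ 2) =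
    (C * cos (t * x) + S * sin (t * x) - N) ^+ 2 by exact: sqr_ge0.
  have -> : 2 * t * x = t * x + t * x by ring.
  rewrite cosD sinD.
  have := cos2Dsin2 (t * x); set c := cos (t * x); set s := sin (t * x) => cs.
  have -> : N / 2 = N / 2 * (c ^+ 2 + s ^+ 2) by rewrite cs mulr1.
  by rewrite /N; field.
have bc : forall s, bounded_measurable (fun x : measurableTypeR R => cos (s * x)) := bcos.
have bs : forall s, bounded_measurable (fun x : measurableTypeR R => sin (s * x)) := bsin.
move: sq_ge0; rewrite !RexpectationD ?RexpectationZ ?Rexpectation_cst ?c2 ?s2//;
  try by do ?[apply: bounded_measurableD => //|apply: bounded_measurableM => //].
rewrite -/C -/S => h.
have : 0 <= N * (1 / 2 - N) by rewrite /N in h *; lra.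
have N0 : 0 <= N by rewrite addr_ge0// sqr_ge0.
by move=> N12; rewrite leNgt; apply/negP => N2; nra.
Qed.

Lemma continuous_charfun : continuous (charfun mu : R -> (R[i])^o).
Proof.
have cont (f : R -> R) : continuous f -> (forall x, `|f x| <= 1) ->
    continuous (fun t : R => \int[mu]_x f (t * x)).
  move=> cf f1 t.
  have mf t' : bounded_measurable (fun x : measurableTypeR R => f (t' * x)).
    split; last by exists 1.
    exact: (measurableT_comp (continuous_measurable_fun cf) (measurable_mulrl t')).
  (* Continuity is local: any window around [t] will do. *)
  apply: (@continuity_under_integral R _ _ mu (fun t x => f (t * x)) setT measurableT
     (t - 1) (t + 1) _ _ (cst 1)) => //=.
  - by move=> t' _; exact: bounded_measurable_integrable.
  - apply: aeW => x _ s _ /=; apply: continuous_comp; last exact: cf.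
    exact: mulrr_continuous.
  - exact: (bounded_measurable_integrable mu (bcst 1)).
  - by move=> s _; apply: aeW => x _.
  - by rewrite inE/= in_itv/=; apply/andP; split; lra.
have cC := cont _ (@continuous_cos R) (@cos_max R).
have cS := cont _ (@continuous_sin R) (@sin_max R).
move=> t; apply/cvgrPdist_lt => -[e e'] /=; rewrite ltcE /= => /andP[/eqP -> e0].
have e20 : 0 < e / 2 by rewrite divr_gt0.
have /cvgrPdist_lt/(_ _ e20) := cC t.
have /cvgrPdist_lt/(_ _ e20) := cS t.
apply: filterS2 => s sS sC.
rewrite (_ : e +i* 0 = e%:C)// normc_def ltcR.
rewrite -[ltRHS](gtr0_norm e0) -sqrtr_sqr ltr_sqrt ?exprn_gt0//.
rewrite /charfun /=; move: sS sC.
set a := _ - _; set b := _ - _; rewrite !ltr_norml => /andP[b1 b2] /andP[a1 a2].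
by nra.
Qed.
End CharfunAnalysis.

(** * Continuous roots *)

Section RootBranch.
Context (R : realType).
Local Notation C := (R[i])^o.

Lemma continuousM_C (f g : R -> C) : continuous f -> continuous g ->
  continuous (fun t => f t * g t : C).
Proof. by move=> cf cg t; exact: (cvgM (cf t) (cg t)). Qed.

Lemma continuous_div (f g : R -> C) : continuous f -> continuous g ->
  (forall t, g t != 0) -> continuous (fun t => f t / g t : C).
Proof.
move=> cf cg g0 t; exact: (cvgM (cf t) (cvgV (g0 t) (cg t))).
Qed.

Lemma continuous_sum_powers (f : R -> C) (k : nat) : continuous f ->
  continuous (fun t => \sum_(i < k) f t ^+ i : C).
Proof.
move=> cf; have cX (i : nat) : continuous (fun t => f t ^+ i : C).
  elim: i => [|i IH]; first exact: cst_continuous.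
  by under [X in continuous X]eq_fun do rewrite exprS; exact: continuousM_C.
elim: k => [|k IH].
  by under [X in continuous X]eq_fun do rewrite big_ord0; exact: cst_continuous.
under [X in continuous X]eq_fun do rewrite big_ord_recr/=.
by move=> t; exact: (cvgD (IH t) (cX k t)).
Qed.

Lemma open_neq0 (f : R -> C) : continuous f -> open [set t | f t != 0].
Proof. by move=> cf; rewrite openE => t /= ft; exact: cvgr_neq0 (cf t) ft. Qed.

(** From [h^k - 1 = (h - 1) * Q] with [Q = 1 + h + ... + h^(k-1)], at each point
    either [h = 1] or [Q = 0], and not both because [Q = k] where [h = 1]. So the
    set where [h = 1] is both open and closed in the connected line. *)
Lemma continuous_unity_root_eq1 (h : R -> C) (k : nat) : (0 < k)%N ->
  continuous h -> (forall t, h t ^+ k = 1) -> h 0 = 1 -> forall t, h t = 1.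
Proof.
move=> k0 ch hk h0 t.
pose Q t : C := \sum_(i < k) h t ^+ i.
have hQ s : (h s - 1) * Q s = 0 by rewrite -subrX1 hk subrr.
have Q1 s : h s = 1 -> Q s != 0.
  move=> hs; rewrite /Q; under eq_bigr do rewrite hs expr1n.
  by rewrite sumr_const card_ord pnatr_eq0 -lt0n.
have cR : connected [set: R] by apply/connected_intervalP.
suff : [set s | h s = 1] = setT by move=> E; have : [set: R] t by []; rewrite -E.
apply: cR; first by exists 0.
- exists [set s | Q s != 0]; first exact/open_neq0/continuous_sum_powers.
  rewrite setTI; apply/seteqP; split => s /=; first exact: Q1.
  by have /eqP := hQ s; rewrite mulf_eq0 subr_eq0 => /orP[/eqP//|->].
- exists [set s | h s = 1]; last by rewrite setTI.
  rewrite -openC (_ : ~` _ = [set s | h s - 1 != 0]).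
    by apply: open_neq0 => s; exact: (cvgB (ch s) (cvg_cst (1 : C))).
  by apply/seteqP; split => s /=; rewrite subr_eq0 => /eqP.
Qed.

End RootBranch.

(** * Absence of zeros *)

Section NonVanishing.
Context (R : realType).
Local Notation normc := (@ComplexField.Normc.normc R : R[i] -> R).

Lemma normcX (z : R[i]) n : normc (z ^+ n) = normc z ^+ n.
Proof.
elim: n => [|n IH]; first by rewrite !expr0 ComplexField.Normc.normc1.
by rewrite !exprS ComplexField.Normc.normcM IH.
Qed.

Lemma normc_sqr (z : R[i]) : normc z ^+ 2 = complex.Re z ^+ 2 + complex.Im z ^+ 2.
Proof. by case: z => a b /=; rewrite sqr_sqrtr// addr_ge0// sqr_ge0. Qed.

Lemma normc_ge0 (z : R[i]) : 0 <= normc z.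
Proof. by case: z => a b; exact: sqrtr_ge0. Qed.

Lemma normc_real (x : R) : 0 <= x -> normc x%:C = x.
Proof. by move=> x0 /=; rewrite expr0n addr0 sqrtr_sqr ger0_norm. Qed.

(** If [psi(2 t) = 0], then each [phi = charfun mu] vanishes at [2 t], hence
    [|phi(t)|^2 <= 1/2]. With [a = |psi(t)|^k > 0] the equation gives
    [a <= |phi(t)|^k (p + a) <= |phi(t)| (p + a)], which fails for [p <= a / 4],
    as it would give [|phi(t)| >= 4/5]. *)
Lemma nonvanishing_double (k : nat) (psi : R -> R[i]) : (0 < k)%N ->
  (forall p : R, 0 < p < 1 ->
    exists mu : probability (measurableTypeR R) R, forall t,
      psi t ^+ k = charfun mu t ^+ k * (p%:C + (1 - p)%:C * psi t ^+ k)) ->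
  forall t, psi t != 0 -> psi (2 * t) != 0.
Proof.
move=> k0 eqn t psit; apply/eqP => psi2t.
pose a : R := normc (psi t ^+ k).
have a0 : 0 < a.
  rewrite lt_def normc_ge0 andbT; apply: contra psit.
  move=> /eqP/ComplexField.Normc.eq0_normc/eqP.
  by rewrite expf_eq0 k0.
(* The factor [1 + a] makes [p < 1] without a bound on [a]. *)
pose p : R := a / (4 * (1 + a)).
have p0 : 0 < p by rewrite divr_gt0// mulr_gt0// addr_gt0.
have p1 : p < 1 by rewrite ltr_pdivrMr ?mulr_gt0 ?addr_gt0//; lra.
have pa : p <= a / 4.
  by rewrite ler_pdivrMr ?mulr_gt0 ?addr_gt0//; nra.
have [|mu psimu] := eqn p; first by rewrite p0 p1.
have phi2 : charfun mu (2 * t) = 0.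
  have /esym/eqP := psimu (2 * t); rewrite psi2t expr0n gtn_eqF//= mulr0 addr0.
  rewrite mulf_eq0 expf_eq0 k0/= => /orP[/eqP//|/eqP[] p00].
  by rewrite p00 ltxx in p0.
have := charfun_sqr_le_half phi2; rewrite -normc_sqr.
have /(congr1 normc) := psimu t; rewrite -/a ComplexField.Normc.normcM normcX.
have := normc_ge0 (charfun mu t); set r := normc (charfun mu t) => r0 ar r2.
have r1 : r <= 1 by nra.
have rk : r ^+ k <= r by rewrite -[leRHS]expr1 ler_wiXn2l.
have np : normc (p%:C + (1 - p)%:C * psi t ^+ k) <= p + a.
  rewrite (le_trans (le_normcD _ _))// normc_real ?(ltW p0)// lerD2l.
  rewrite ComplexField.Normc.normcM normc_real; last by rewrite subr_ge0 ltW.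
  by rewrite -/a; nra.
have : a <= r * (p + a).
  by rewrite {1}ar ler_pM// ?normc_ge0// exprn_ge0.
nra.
Qed.

Lemma nonvanishing_of_double (psi : R -> R[i]) :
  continuous (psi : R -> (R[i])^o) -> psi 0 = 1 ->
  (forall t, psi t != 0 -> psi (2 * t) != 0) -> forall t, psi t != 0.
Proof.
move=> cpsi psi0 dbl t.
(* Iterated doubling, read backwards. *)
have halve n s : psi (s / 2 ^+ n) != 0 -> psi s != 0.
  elim: n s => [|n IH] s; first by rewrite expr0 divr1.
  move=> h; apply: IH; have := dbl _ h; congr (psi _ != 0).
  by rewrite exprS; field; rewrite expf_neq0.
have : \forall s \near (0 : R), psi s != 0.
  have psi0_neq0 : psi 0 != 0 by rewrite psi0 oner_neq0.
  exact: cvgr_neq0 (cpsi 0) psi0_neq0.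
move=> /nbhs_ballP[e /= e0 eP].
have [n tn] : exists n : nat, `|t| / e < 2 ^+ n.
  exists (Num.truncn (`|t| / e)).+1.
  apply: (lt_le_trans (truncnS_gt _)).
  by rewrite -natrX ler_nat ltnW// ltn_expl.
apply: (halve n); apply: eP; rewrite /ball/= sub0r normrN normrM normfV.
rewrite [X in _ / X]ger0_norm ?exprn_ge0// ltr_pdivrMr ?exprn_gt0//.
by rewrite mulrC -ltr_pdivrMr.
Qed.

End NonVanishing.

(** * The stationary law is randomly self-decomposable *)

Theorem proposition2 (R : realType) (k : nat) (psiY : R -> R[i]) :
  (1 <= k)%N ->
  is_CF psiY ->
  (forall c p : R, 0 < c <= 1 -> 0 <= p < 1 ->
    exists (d : measure_display) (T : measurableType d) (P : probability T R)
      (Y eps : int -> 'I_k -> {RV P >-> measurableTypeR R})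
      (chi : int -> {RV P >-> bool}),
      stationary_GAR1 c p Y eps chi /\
      forall n i t, charfun (distribution P (Y n i)) t = psiY t) ->
  HRSD k psiY.
Proof.
move=> k0 [muY psiE] model.
have eqn (c p : R) : 0 < c <= 1 -> 0 <= p < 1 ->
    exists mu : probability (measurableTypeR R) R, forall t,
      psiY t ^+ k = charfun mu t ^+ k *
        (p%:C + (1 - p)%:C * psiY (c * t) ^+ k).
  move=> hc hp; have [d [T [P [Y [eps [chi [ar Ypsi]]]]]]] := model c p hc hp.
  exists (distribution P (eps 0 (Ordinal k0))).
  exact: GAR1_functional_equation ar Ypsi.
have psi_charfun : psiY = charfun muY by exact/funext.
have psi_cont : continuous (psiY : R -> (R[i])^o).
  by rewrite psi_charfun; exact: continuous_charfun.
have psi0 : psiY 0 = 1 by rewrite psi_charfun charfun0.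
have psi_neq0 : forall t, psiY t != 0.
  apply: nonvanishing_of_double => //; apply: (nonvanishing_double k0).
  move=> p /andP[p0 p1]; have [||mu mueqn] := eqn 1 p.
  - by rewrite ltr01 lexx.
  - by rewrite (ltW p0) p1.
  - by exists mu => t; have := mueqn t; rewrite mul1r.
split; first by exists muY.
move=> c p hc hp; have [mu mueqn] := eqn c p hc hp.
pose phi := charfun mu.
have /all_and2[phi_neq0 f_neq0] : forall t, phi t != 0 /\
    p%:C + (1 - p)%:C * psiY (c * t) ^+ k != 0.
  move=> t; have : psiY t ^+ k != 0 by rewrite expf_neq0.
  by rewrite mueqn mulf_eq0 negb_or expf_eq0 k0 => /andP[].
pose g t : R[i] := psiY t / phi t.
have g_cont : continuous (g : R -> (R[i])^o).
  exact: (continuous_div psi_cont (@continuous_charfun _ mu) phi_neq0).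
have g0 : g 0 = 1 by rewrite /g psi0 /phi charfun0 divr1.
have gk t : g t ^+ k = p%:C + (1 - p)%:C * psiY (c * t) ^+ k.
  by rewrite /g expr_div_n (mueqn t) -/(phi t) mulrAC mulfV ?mul1r// expf_neq0.
exists phi, g; split; first by exists mu.
- rewrite /harris_root; case: eqP => [p0|_]; last by split.
  have psic_cont : continuous ((fun t => psiY (c * t)) : R -> (R[i])^o).
    move=> t; apply: continuous_comp; [exact: mulrl_continuous | exact: psi_cont].
  (* For [p = 0] the candidate must be the specific branch [psi(c t)]. *)
  have h1 := continuous_unity_root_eq1 k0
    (continuous_div g_cont psic_cont (fun t => psi_neq0 (c * t))).
  move=> t; apply: (mulIf (invr_neq0 (psi_neq0 (c * t)))).
  rewrite mulfV//; apply: h1 => [s|].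
    by rewrite expr_div_n gk p0 add0r subr0 mul1r divff// expf_neq0.
  by rewrite g0 mulr0 psi0 divr1.
- by move=> t; rewrite /g mulrC divfK.
Qed.
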